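(* Let $r,s$ be positive integers, $Q\subseteq[r]\times[s]$, and let $I\subseteq\mathbb{K}[x]=\mathbb{K}[x_1,\dots,x_r]$ and $J\subseteq\mathbb{K}[y]=\mathbb{K}[y_1,\dots,y_s]$ be ideals homogeneous with respect to total degree. Let $F\subseteq I$ be a Gröbner basis of $I$ with respect to a weight $\omega_1\in\mathbb{R}^r$ and $G\subseteq J$ a Gröbner basis of $J$ with respect to a weight $\omega_2\in\mathbb{R}^s$, such that every element of $F$ is weakly $Q$-homogeneous with respect to $\omega_1$ and every element of $G$ is weakly $Q$-homogeneous with respect to $\omega_2$ (in the sense below). Then \[ \operatorname{Lift}(F)\cup\operatorname{Lift}(G)\cup H_Q \] is a pseudo-Gröbner basis of $I\times_Q J$ with respect to the weight $\omega^TB_Q$, where $\omega=(\omega_1,\omega_2)$ and $B_Q\in\mathbb{Z}^{(r+s)\times\#Q}$ is the matrix of exponent vectors of $\phi_Q$.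
   Context: $\phi_Q:\mathbb{K}[z_{jk}:(j,k)\in Q]\to\mathbb{K}[x,y]$ is the homomorphism $z_{jk}\mapsto x_jy_k$, and $I_Q=\ker\phi_Q$. The quasi-independence gluing is $I\times_QJ:=\phi_Q^{-1}(I+J)$. $G_Q$ is the bipartite graph on vertex sets $[r]$ and $[s]$ (disjoint copies) with edge set $Q$. $H_Q$ is the set of binomials $\prod_{i=1}^\ell z_{j_ik_i}-\prod_{i=1}^\ell z_{j_{i+1}k_i}$ (indices mod $\ell$), one for each induced cycle $j_1-k_1-j_2-k_2-\cdots-j_\ell-k_\ell-j_1$ of $G_Q$. For a weight $\omega$, $\mathrm{in}_\omega(f)$ is the sum of terms of $f$ of maximal $\omega$-weight, and a finite set $P\subseteq K$ is a pseudo-Gröbner basis of an ideal $K$ with respect to $\omega$ if $\langle \mathrm{in}_\omega(P)\rangle=\mathrm{in}_\omega(K)$ (initial forms need not be monomials). Weak $Q$-homogeneity: a polynomial $f\in\mathbb{K}[x]$ homogeneous in total degree $d$ whose $\omega$-initial form is (a scalar multiple of) the monomial $x_{j_1}\cdots x_{j_d}$ is weakly $Q$-homogeneous with respect to $\omega$ if for every monomial $x_{j'_1}\cdots x_{j'_d}$ of $f$ there is a permutation $\sigma$ of $[d]$ with $\{(k_1,\dots,k_d)\in[s]^d:(j_\ell,k_\ell)\in Q\ \forall\ell\}\subseteq\{(k_1,\dots,k_d)\in[s]^d:(j'_{\sigma(\ell)},k_\ell)\in Q\ \forall\ell\}$. For polynomials in $\mathbb{K}[y]$ the definition is the same with the roles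 of the two coordinates of $Q$ swapped. Lifts: write a weakly $Q$-homogeneous $f=\sum_\ell c_\ell x_{j_{\ell,1}}\cdots x_{j_{\ell,d}}$ with leading monomial $x_{j_{*,1}}\cdots x_{j_{*,d}}$, each monomial's factors being ordered (by such a permutation) so that $(j_{*,i},k_i)\in Q$ for all $i$ implies $(j_{\ell,i},k_i)\in Q$ for all $i,\ell$. For $k=(k_1,\dots,k_d)\in[s]^d$ with $(j_{*,i},k_i)\in Q$ for all $i$, the lift is $f_k=\sum_\ell c_\ell z_{j_{\ell,1}k_1}\cdots z_{j_{\ell,d}k_d}$, and $\operatorname{Lift}(f)$ is the set of all such $f_k$; $\operatorname{Lift}(F)=\bigcup_{f\in F}\operatorname{Lift}(f)$. Lifts of elements of $\mathbb{K}[y]$ are defined symmetrically (lifting by first indices $j$). *)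

(* Defs.v *)
From HB Require Import structures.
From mathcomp Require Import all_boot all_order all_algebra all_fingroup.
From mathcomp Require Import mpoly.

Set Implicit Arguments.
Unset Strict Implicit.
Unset Printing Implicit Defensive.

Import Order.TTheory GRing.Theory Num.Theory.
Local Open Scope ring_scope.

Section Generic.
Variables (K : fieldType).

Definition is_ideal n (I : {mpoly K[n]} -> Prop) : Prop :=
  [/\ I 0,
      forall f g, I f -> I g -> I (f + g) &
      forall a f, I f -> I (a * f)].

Definition ideal_gen n (S : {mpoly K[n]} -> Prop) : {mpoly K[n]} -> Prop :=
  fun f => exists l : seq ({mpoly K[n]} * {mpoly K[n]}),
    (forall p, p \in l -> S p.2) /\ f = \sum_(p <- l) p.1 * p.2.

Definition is_homog n (d : nat) (f : {mpoly K[n]}) : bool :=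
  all (fun m : 'X_{1..n} => mdeg m == d) (msupp f).

Definition hcomp n (d : nat) (f : {mpoly K[n]}) : {mpoly K[n]} :=
  \sum_(m <- msupp f | mdeg m == d) f@_m *: 'X_[m].

Definition homog_ideal n (I : {mpoly K[n]} -> Prop) : Prop :=
  is_ideal I /\ forall f d, I f -> I (hcomp d f).

Variable (R : realFieldType).

Definition mwt n (w : 'rV[R]_n) (m : 'X_{1..n}) : R :=
  \sum_(i < n) w 0 i * (m i)%:R.

Definition init_form n (w : 'rV[R]_n) (f : {mpoly K[n]}) : {mpoly K[n]} :=
  \sum_(m <- msupp f | all (fun m' => mwt w m' <= mwt w m) (msupp f))
     f@_m *: 'X_[m].

Definition init_ideal n (w : 'rV[R]_n) (I : {mpoly K[n]} -> Prop) :=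
  ideal_gen (fun g => exists2 f, I f & g = init_form w f).

Definition finite_set (T : eqType) (P : T -> Prop) : Prop :=
  exists s : seq T, forall x, P x <-> x \in s.

Definition pseudo_GB n (w : 'rV[R]_n) (P I : {mpoly K[n]} -> Prop) : Prop :=
  [/\ finite_set P,
      (forall f, P f -> I f) &
      forall g, ideal_gen (fun h => exists2 f, P f & h = init_form w f) g
                <-> init_ideal w I g].

Definition is_GB n (w : 'rV[R]_n) (F : seq {mpoly K[n]})
  (I : {mpoly K[n]} -> Prop) : Prop :=
  pseudo_GB w (fun f => f \in F) I /\
  forall f, f \in F -> exists c m, c != 0 /\ init_form w f = c *: 'X_[m].

(* ---------- weak Q-homogeneity (generic in the adjacency relation) -------
   A monomial x_{j_1}...x_{j_d} is represented by the ordered list of its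
   factor indices [:: j_1; ...; j_d].  adj j k expresses "(j,k) in Q" (for
   polynomials in x) resp. "(k,j) in Q" (for polynomials in y).
   The set {(k_1..k_d) : (j_l,k_l) in Q forall l} is {ks | all2 adj js ks}. *)
Definition mono_of n (js : seq 'I_n) : {mpoly K[n]} := \prod_(j <- js) 'X_j.

Definition weakly_Qhomog n m (adj : 'I_n -> 'I_m -> bool) (w : 'rV[R]_n)
  (f : {mpoly K[n]}) : Prop :=
  exists d, is_homog d f /\
  exists (c : K) (mL : 'X_{1..n}), c != 0 /\ init_form w f = c *: 'X_[mL] /\
  forall js : seq 'I_n, mono_of js = 'X_[mL] ->
  forall mm, mm \in msupp f ->
  forall js' : seq 'I_n, mono_of js' = 'X_[mm] ->
  exists2 sjs' : seq 'I_n, perm_eq js' sjs' &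
     forall ks : seq 'I_m, all2 adj js ks -> all2 adj sjs' ks.

Definition admissible_ordering n m (adj : 'I_n -> 'I_m -> bool)
  (w : 'rV[R]_n) (f : {mpoly K[n]}) (ord : 'X_{1..n} -> seq 'I_n) : Prop :=
  (forall mm, mm \in msupp f -> mono_of (ord mm) = 'X_[mm]) /\
  forall (c : K) (mL : 'X_{1..n}), c != 0 -> init_form w f = c *: 'X_[mL] ->
  forall mm, mm \in msupp f ->
  forall ks : seq 'I_m, all2 adj (ord mL) ks -> all2 adj (ord mm) ks.

Definition lift_k n m N (z : 'I_n -> 'I_m -> {mpoly K[N]})
  (f : {mpoly K[n]}) (ord : 'X_{1..n} -> seq 'I_n) (ks : seq 'I_m)
  : {mpoly K[N]} :=
  \sum_(mm <- msupp f) f@_mm *: \prod_(p <- zip (ord mm) ks) z p.1 p.2.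

Definition Lift n m N (adj : 'I_n -> 'I_m -> bool)
  (z : 'I_n -> 'I_m -> {mpoly K[N]}) (w : 'rV[R]_n)
  (f : {mpoly K[n]}) (ord : 'X_{1..n} -> seq 'I_n) : {mpoly K[N]} -> Prop :=
  fun g => exists (c : K) (mL : 'X_{1..n}) (ks : seq 'I_m),
    [/\ c != 0, init_form w f = c *: 'X_[mL], all2 adj (ord mL) ks &
        g = lift_k z f ord ks].

End Generic.

Section Gluing.
Variables (K : fieldType) (r s : nat) (Q : {set 'I_r * 'I_s}).

(* z-variables are indexed by 'I_#|Q|, the index i standing for z_{enum_val i} *)
Definition zidx (i : 'I_#|Q|) : 'I_r * 'I_s := @enum_val _ (mem Q) i.

(* z_{jk} (only meaningful for (j,k) in Q; 0 otherwise) *)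
Definition zvar (j : 'I_r) (k : 'I_s) : {mpoly K[#|Q|]} :=
  if [pick i | zidx i == (j, k)] is Some i then 'X_i else 0.

(* phi_Q : z_{jk} |-> x_j y_k, with x_j = X_(lshift s j), y_k = X_(rshift r k) *)
Definition phiQ (p : {mpoly K[#|Q|]}) : {mpoly K[r + s]} :=
  mmap (@mpolyC (r + s) K)
    (fun i => 'X_(lshift s (zidx i).1) * 'X_(rshift r (zidx i).2)) p.

Definition incx (p : {mpoly K[r]}) : {mpoly K[r + s]} :=
  mmap (@mpolyC (r + s) K) (fun j => 'X_(lshift s j)) p.
Definition incy (p : {mpoly K[s]}) : {mpoly K[r + s]} :=
  mmap (@mpolyC (r + s) K) (fun k => 'X_(rshift r k)) p.

Definition ideal_sum (I : {mpoly K[r]} -> Prop) (J : {mpoly K[s]} -> Prop)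
  : {mpoly K[r + s]} -> Prop :=
  ideal_gen (fun h => (exists2 f, I f & h = incx f) \/
                      (exists2 g, J g & h = incy g)).

Definition glue (I : {mpoly K[r]} -> Prop) (J : {mpoly K[s]} -> Prop)
  : {mpoly K[#|Q|]} -> Prop :=
  fun p => ideal_sum I J (phiQ p).

(* H_Q: binomials of the induced cycles j_1-k_1-...-j_l-k_l-j_1 of G_Q *)
Definition HQ : {mpoly K[#|Q|]} -> Prop :=
  fun g => exists (l : nat) (js : 'I_l -> 'I_r) (ks : 'I_l -> 'I_s),
    [/\ (2 <= l)%N, injective js, injective ks,
        (* edges among the cycle vertices are exactly the cycle edges
           (j_a,k_a) and (j_{a+1},k_a): the cycle is induced *)
        (forall a b : 'I_l,
            ((js a, ks b) \in Q) = (a == b) || (a == ordS b)) &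
        g = \prod_(i < l) zvar (js i) (ks i)
            - \prod_(i < l) zvar (js (ordS i)) (ks i)].

Definition BQ : 'M[int]_(r + s, #|Q|) :=
  \matrix_(i, q) ((i == lshift s (zidx q).1)%:R + (i == rshift r (zidx q).2)%:R).

Definition adjx (j : 'I_r) (k : 'I_s) : bool := (j, k) \in Q.
Definition adjy (k : 'I_s) (j : 'I_r) : bool := (j, k) \in Q.

End Gluing.

(* Main.v *)
Require Import Defs.
From HB Require Import structures.
From mathcomp Require Import all_boot all_order all_algebra all_fingroup.
From mathcomp Require Import ssrcomplements mpoly zify.
From Stdlib Require Import Classical ClassicalEpsilon.

Set Implicit Arguments.
Unset Strict Implicit.
Unset Printing Implicit Defensive.

Import Order.TTheory GRing.Theory Num.Theory.
Local Open Scope ring_scope.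

(** phi_Q maps each monomial z^m to a monomial x^a y^b. By weight-homogeneity of
    phi_Q, if f lies in the glued ideal then phi_Q(in f) is either 0 or the
    initial form of phi_Q(f), an element of I + J. A monomial x^a y^b of the
    latter has x^a in in(I) or y^b in in(J): otherwise normal forms modulo I and
    J yield linear functionals alpha and beta, vanishing on I and J and
    supported on x^a resp. y^b and on monomials of larger weight, and their
    product kills I + J but not phi_Q(f). If the leading monomial of some
    element of F or G divides x^a or y^b, the initial monomial of a suitable
    lift divides each z^m lying over x^a y^b.

    What remains is that the kernel of phi_Q is generated by H_Q. For z^m - z^m'
    in the kernel with coprime terms, walk alternately along edges of m and of
    m'. A shortest such walk that an edge of G_Q closes, starting in either
    monomial, is an induced cycle; exchanging its edges in one monomial is a
    move by a multiple of an element of H_Q and creates a common factor with the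
    other one, so one can induct on the degree. *)

(** * Ideals and generated ideals *)

Section Ideals.
Variables (K : fieldType) (n : nat).
Implicit Types (I S : {mpoly K[n]} -> Prop) (f g : {mpoly K[n]}).

Lemma ideal_gen_ideal S : is_ideal (ideal_gen S).
Proof.
split.
- by exists [::]; rewrite big_nil.
- move=> f g [l1 [h1 ->]] [l2 [h2 ->]]; exists (l1 ++ l2).
  rewrite big_cat; split=> // p; rewrite mem_cat => /orP[]; [exact: h1|exact: h2].
- move=> a f [l [h ->]]; exists [seq (a * p.1, p.2) | p <- l]; split.
    by move=> p /mapP[p' /h ? ->].
  by rewrite big_map mulr_sumr; apply: eq_bigr => p _; rewrite mulrA.
Qed.

Lemma mem_ideal_gen S f : S f -> ideal_gen S f.
Proof.
move=> Sf; exists [:: (1, f)]; rewrite big_seq1 mul1r; split=> // p.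
by rewrite inE => /eqP ->.
Qed.

Lemma idealZ I c f : is_ideal I -> I f -> I (c *: f).
Proof. by case=> _ _ h /h; rewrite -mul_mpolyC; apply. Qed.

Lemma idealB I f g : is_ideal I -> I f -> I g -> I (f - g).
Proof.
move=> idI If Ig; rewrite -scaleN1r.
by case: (idI) => _ hD _; apply: hD => //; apply: idealZ.
Qed.

Lemma ideal_subC I f g : is_ideal I -> I (f - g) -> I (g - f).
Proof. by move=> idI h; rewrite -opprB -scaleN1r; apply: idealZ. Qed.

Lemma ideal_big I (T : eqType) (s : seq T) (h : T -> {mpoly K[n]}) :
  is_ideal I -> (forall i, i \in s -> I (h i)) -> I (\sum_(i <- s) h i).
Proof.
case=> I0 ID _ hs; rewrite big_seq.
by apply: (big_ind I) => // i; apply: hs.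
Qed.

Lemma ideal_gen_min S I f :
  is_ideal I -> (forall g, S g -> I g) -> ideal_gen S f -> I f.
Proof.
move=> idI SI [l [hl ->]]; apply: ideal_big => // p /hl /SI.
by case: idI => _ _; apply.
Qed.

End Ideals.

(** * Linear functionals on polynomials *)

Section LinearExtension.
Variables (K : fieldType) (n : nat).
Implicit Types (a : 'X_{1..n} -> K) (p q : {mpoly K[n]}).

(** A functional is encoded by its values on monomials, so that functionals in x and in y can be
    multiplied pointwise on exponents. *)
Definition lin a p : K := \sum_(m <- msupp p) p@_m * a m.

(** A degree bound provides one index set shared by several polynomials, on which linearity can be
    checked termwise. *)
Lemma linwE a p i : (msize p <= i)%N ->
  lin a p = \sum_(m : 'X_{1..n < i}) p@_m * a m.
Proof.
move=> le_pi; rewrite /lin.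
rewrite (big_mksub ('X_{1..n < i} : subFinType _)) ?msupp_uniq //=; last first.
  by move=> x /msize_mdeg_lt /leq_trans; apply.
by rewrite big_rmcond //= => j /memN_msupp_eq0 ->; rewrite mul0r.
Qed.

Lemma linP a c p q : lin a (c *: p + q) = c * lin a p + lin a q.
Proof.
set i := maxn (msize p) (maxn (msize q) (msize (c *: p + q))).
rewrite !(@linwE a _ i) ?leq_max ?leqnn ?orbT //.
rewrite mulr_sumr -big_split /=; apply: eq_bigr => m _.
by rewrite mcoeffD mcoeffZ mulrDl mulrA.
Qed.

Lemma linX a m : lin a 'X_[m] = a m.
Proof. by rewrite /lin msuppX big_seq1 mcoeffX eqxx mul1r. Qed.

Lemma lin0 a : lin a 0 = 0.
Proof. by rewrite /lin msupp0 big_nil. Qed.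

Lemma lin_sum a (T : Type) (s : seq T) (c : T -> K) (p : T -> {mpoly K[n]}) :
  lin a (\sum_(i <- s) c i *: p i) = \sum_(i <- s) c i * lin a (p i).
Proof.
elim: s => [|i s IH]; first by rewrite !big_nil lin0.
by rewrite !big_cons linP IH.
Qed.

Lemma eq_lin a b p : a =1 b -> lin a p = lin b p.
Proof. by move=> ab; apply: eq_bigr => m _; rewrite ab. Qed.

End LinearExtension.

(** * Exponent maps of monomial substitutions *)

Section MonomialSubstitution.
Variables (K : fieldType) (n N : nat) (u : 'I_n -> 'X_{1..N}).

Definition msubst (m : 'X_{1..n}) : 'X_{1..N} := (\sum_i u i *+ m i)%MM.

Lemma msubst0 : msubst 0%MM = 0%MM.
Proof. by apply: big1 => i _; rewrite mnm0E mulm0n. Qed.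

Lemma msubstD m1 m2 : msubst (m1 + m2)%MM = (msubst m1 + msubst m2)%MM.
Proof.
apply/mnmP => j; rewrite mnmDE /msubst !mnm_sumE -big_split /=.
by apply: eq_bigr => i _; rewrite !mulmnE mnmDE mulnDr.
Qed.

Lemma msubstU i : msubst U_(i)%MM = u i.
Proof.
apply/mnmP => j; rewrite /msubst mnm_sumE (bigD1 i) //= big1 => [|k /negPf ki].
  by rewrite mulmnE mnm1E eqxx muln1 addn0.
by rewrite mulmnE mnm1E eq_sym ki muln0.
Qed.

Lemma msubst_sum (T : Type) (s : seq T) (f : T -> 'X_{1..n}) :
  msubst (\sum_(i <- s) f i)%MM = (\sum_(i <- s) msubst (f i))%MM.
Proof. by apply: (big_morph msubst msubstD msubst0). Qed.

Lemma mmap_msubst (h : 'I_n -> {mpoly K[N]}) :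
  (forall i, h i = 'X_[u i]) ->
  forall p, mmap (@mpolyC N K) h p
            = \sum_(m <- msupp p) p@_m *: 'X_[msubst m].
Proof.
move=> hE p; apply: eq_bigr => m _; rewrite mul_mpolyC; congr (_ *: _).
by rewrite /mmap1 -mprodXnE; apply: eq_bigr => i _; rewrite hE.
Qed.

End MonomialSubstitution.

(** * Weights and initial forms *)

Section InitialForms.
Variables (K : fieldType) (R : realFieldType) (n : nat) (w : 'rV[R]_n).
Implicit Types (f g : {mpoly K[n]}) (m : 'X_{1..n}).

Lemma mwtD m1 m2 : mwt w (m1 + m2)%MM = mwt w m1 + mwt w m2.
Proof.
by rewrite /mwt -big_split; apply: eq_bigr => i _; rewrite mnmDE natrD mulrDr.
Qed.

Lemma mwt0 : mwt w 0%MM = 0.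
Proof. by rewrite /mwt big1 // => i _; rewrite mnm0E mulr0. Qed.

Lemma mwtU i : mwt w U_(i)%MM = w 0 i.
Proof.
rewrite /mwt (bigD1 i) //= big1 => [|j /negPf ji].
  by rewrite mnm1E eqxx mulr1 addr0.
by rewrite mnm1E eq_sym ji mulr0.
Qed.

Lemma mwt_sum (T : Type) (s : seq T) (F : T -> 'X_{1..n}) :
  mwt w (\sum_(i <- s) F i)%MM = \sum_(i <- s) mwt w (F i).
Proof. by apply: (big_morph (mwt w) mwtD mwt0). Qed.

(** The monomial [m] need not lie in the support of [f]; outside it the coefficient vanishes
    anyway. *)
Definition topw f m := all (fun m' => mwt w m' <= mwt w m) (msupp f).

Lemma mcoeff_init_form f m :
  (init_form w f)@_m = if topw f m then f@_m else 0.
Proof.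
rewrite /init_form raddf_sum /= -big_filter.
under eq_bigr do rewrite mcoeffZ mcoeffX.
set s := [seq _ <- _ | _].
have us : uniq s by rewrite filter_uniq ?msupp_uniq.
have [ms|ms] := boolP (m \in s).
  rewrite (bigD1_seq m) //= eqxx mulr1 big1 ?addr0 => [|m' /negPf mm'].
    by move: ms; rewrite mem_filter => /andP[+ _]; rewrite -/(topw f m) => ->.
  by rewrite mm' mulr0.
rewrite big_seq big1 => [|m' m's]; last first.
  by case: eqP => [m'm|_]; rewrite ?mulr0 //; move: ms; rewrite -m'm m's.
case: ifP => // tm; apply/esym/eqP; rewrite mcoeff_eq0.
by move: ms; rewrite mem_filter -/(topw f m) tm.
Qed.

Lemma msupp_init_form f m :
  (m \in msupp (init_form w f)) = (m \in msupp f) && topw f m.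
Proof.
by rewrite !mcoeff_msupp mcoeff_init_form; case: topw; rewrite ?andbT ?eqxx ?andbF.
Qed.

Lemma init_form_homog f :
  (forall m m', m \in msupp f -> m' \in msupp f -> mwt w m = mwt w m') ->
  init_form w f = f.
Proof.
move=> h; apply/mpolyP => m; rewrite mcoeff_init_form; case: ifP => // tm.
apply/esym/eqP; rewrite mcoeff_eq0; apply/negP => mf; move/negP: tm; apply.
by apply/allP => m' m'f; rewrite (h m' m).
Qed.

Lemma init_form_lead c m f : c != 0 ->
  (forall m', m' \in msupp f -> mwt w m' < mwt w m) ->
  init_form w (c *: 'X_[m] + f) = c *: 'X_[m].
Proof.
move=> c0 h; have mf : f@_m = 0.
  by apply: memN_msupp_eq0; apply/negP => /h; rewrite ltxx.
have sup m' : m' \in msupp (c *: 'X_[m] + f) -> m' = m \/ m' \in msupp f.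
  move/msuppD_le; rewrite mem_cat msuppMCX // inE => /orP[/eqP|]; by [left|right].
apply/mpolyP => m'; rewrite mcoeff_init_form !mcoeffD !mcoeffZ mcoeffX.
have [<-|nm] := eqVneq m m'.
  rewrite mf addr0 ifT //; apply/allP => m'' /sup[->//|/h /ltW //].
rewrite mulr0 add0r; case: ifP => // tm.
apply/eqP; rewrite mcoeff_eq0; apply/negP => /h; apply/negP; rewrite -leNgt.
apply: (allP tm); rewrite mcoeff_msupp mcoeffD mcoeffZ mcoeffX eqxx mulr1 mf.
by rewrite addr0.
Qed.

Lemma init_form_monomial f c m : c != 0 -> init_form w f = c *: 'X_[m] ->
  [/\ m \in msupp f, f@_m = c &
      forall m', m' \in msupp f -> m' != m -> mwt w m' < mwt w m].
Proof.
move=> c0 inf.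
have minf : m \in msupp (init_form w f) by rewrite inf msuppMCX ?inE.
move: (minf); rewrite msupp_init_form => /andP[mf tm]; split=> //.
  by move/(congr1 (mcoeff m)): inf; rewrite mcoeff_init_form tm mcoeffZ mcoeffX eqxx mulr1.
move=> m' m'f nm; rewrite lt_neqAle (allP tm) // andbT; apply/eqP => wm.
have : m' \in msupp (init_form w f).
  by rewrite msupp_init_form m'f; apply/allP => m'' /(allP tm); rewrite wm.
by rewrite inf msuppMCX // inE (negPf nm).
Qed.

Lemma init_form_neq0 f : f != 0 -> exists m, m \in msupp (init_form w f).
Proof.
rewrite -msupp_eq0 => nf.
suff [m mf tm] : exists2 m, m \in msupp f & topw f m.
  by exists m; rewrite msupp_init_form mf.
rewrite /topw; elim: (msupp f) nf => // m0 s IH _.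
have [s0|/IH [m ms /allP tm]] := eqVneq s [::].
  by exists m0; rewrite s0 ?inE //= lexx.
have [le|lt] := leP (mwt w m0) (mwt w m).
  exists m; rewrite ?inE ?ms ?orbT //=; rewrite le; exact/allP.
exists m0; rewrite ?inE ?eqxx //= lexx; apply/allP => m' /tm /le_trans; apply.
exact: ltW.
Qed.

End InitialForms.

(** * Alternating walks and induced cycles in bipartite graphs *)

Section InducedCycles.
Variables (T1 T2 : finType) (Q : T1 -> T2 -> bool).
Implicit Types A B : T1 -> T2 -> bool.

Definition induced_cycle l (js : 'I_l -> T1) (ks : 'I_l -> T2) : Prop :=
  [/\ (2 <= l)%N, injective js, injective ks &
      forall a b, Q (js a) (ks b) = (a == b) || (a == ordS b)].

(** Only one of the edges of the second kind is asked to lie in [B]: the edge that closes a walk is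
    merely an edge of [Q], and one edge of [B] suffices to create a common factor after the
    exchange. *)
Definition alternating_cycle A B : Prop :=
  exists l (js : 'I_l -> T1) (ks : 'I_l -> T2),
    [/\ induced_cycle js ks, (forall i, A (js i) (ks i)) &
        exists i, B (js (ordS i)) (ks i)].

(** Strong induction on the length: a chord closes a shorter walk, and a walk without chords is
    itself an induced cycle. *)
Lemma closed_walk_cycle b A B (js : nat -> T1) (ks : nat -> T2) :
  (0 < b)%N ->
  (forall j k, A j k -> Q j k) -> (forall j k, B j k -> Q j k) ->
  (forall j k, A j k -> B j k -> False) ->
  (forall i, (i <= b)%N -> A (js i) (ks i)) ->
  (forall i, (i < b)%N -> B (js i.+1) (ks i)) ->
  Q (js 0%N) (ks b) ->
  alternating_cycle A B \/ alternating_cycle B A.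
Proof.
elim/ltn_ind: b A B js ks => b IH A B js ks b0 AQ BQ dAB hA hB hQ.
(* A forward chord other than the closing edge closes the shorter walk between its endpoints. *)
have [/existsP[a /existsP[c /and3P[Qac ltac nac]]]|noF] := boolP
  [exists a : 'I_b.+1, exists c : 'I_b.+1,
    [&& Q (js a) (ks c), a < c & (a != 0 :> nat) || (c != b :> nat)]]%N.
  move: (ltn_ord a) (ltn_ord c) => lta ltc.
  apply: (IH (c - a)%N _ A B (fun i => js (a + i)%N) (fun i => ks (a + i)%N)) => //.
  - by lia.
  - by lia.
  - by move=> i hi; apply: hA; lia.
  - by move=> i hi; rewrite addnS; apply: hB; lia.
  - by rewrite addn0 subnKC // ltnW.
have {}noF a c : (a < c)%N -> (c <= b)%N -> (a != 0%N) || (c != b) ->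
    Q (js a) (ks c) = false.
  move=> ac cb nac; apply/negP => Qac; move/negP: noF; apply.
  have ab : (a < b.+1)%N by lia.
  apply/existsP; exists (Ordinal ab); apply/existsP; exists (@Ordinal b.+1 c cb).
  by rewrite /= Qac ac.
(* A backward chord closes the same walk read in reverse, with A and B
   exchanged. *)
have [/existsP[a /existsP[c /andP[Qac ltca]]]|noB] := boolP
  [exists a : 'I_b.+1, exists c : 'I_b.+1, Q (js a) (ks c) && (c.+1 < a)]%N.
  move: (ltn_ord a) (ltn_ord c) => lta ltc.
  suff [h|h] : alternating_cycle B A \/ alternating_cycle A B; [by right|by left|].
  apply: (IH (a - c.+1)%N _ B A (fun i => js (a - i)%N)
             (fun i => ks (a.-1 - i)%N)) => //.
  - by lia.
  - by lia.
  - by move=> j k Bjk Ajk; apply: (dAB j k).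
  - move=> i hi; have -> : (a - i = (a.-1 - i).+1)%N by lia.
    by apply: hB; lia.
  - move=> i hi; have -> : (a - i.+1 = a.-1 - i)%N by lia.
    by apply: hA; lia.
  - by rewrite subn0; have -> : (a.-1 - (a - c.+1) = c)%N by lia.
have {}noB a c : (c.+1 < a)%N -> (a <= b)%N -> Q (js a) (ks c) = false.
  move=> ca ab; apply/negP => Qac; move/negP: noB; apply.
  have cb : (c < b.+1)%N by lia.
  apply/existsP; exists (@Ordinal b.+1 a ab); apply/existsP; exists (Ordinal cb).
  by rewrite /= Qac ca.
(* At a repeated vertex, the [B]-edge next to one of its occurrences either coincides with an
   [A]-edge, against disjointness, or is a forward chord. The same argument serves for [ks]. *)
have injj a c : (a < c)%N -> (c <= b)%N -> js a <> js c.
  move=> ac cb e.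
  have Bc : B (js a) (ks c.-1) by rewrite e -{1}(ltn_predK ac); apply: hB; lia.
  have [ca|ca] := eqVneq a c.-1.
    by apply: (dAB _ _ (hA a _)); [lia | rewrite {2}ca].
  by move: (BQ _ _ Bc); rewrite noF //; lia.
have injk a c : (a < c)%N -> (c <= b)%N -> ks a <> ks c.
  move=> ac cb e.
  have Bc : B (js a.+1) (ks c) by rewrite -e; apply: hB; lia.
  have [ca|ca] := eqVneq a.+1 c.
    by apply: (dAB _ _ (hA c _)) => //; rewrite -{1}ca.
  by move: (BQ _ _ Bc); rewrite noF //; lia.
left; exists b.+1, (fun i => js i), (fun i => ks i); split.
- split.
  + by lia.
  + move=> a c e; apply: val_inj => /=; move: (ltn_ord a) (ltn_ord c) => lta ltc.
    by case: (ltngtP a c) => // h; [case: (injj _ _ h)|case: (injj _ _ h)].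
  + move=> a c e; apply: val_inj => /=; move: (ltn_ord a) (ltn_ord c) => lta ltc.
    by case: (ltngtP a c) => // h; [case: (injk _ _ h)|case: (injk _ _ h)].
  + move=> a c; move: (ltn_ord a) (ltn_ord c) => lta ltc.
    rewrite -[a == c]val_eqE -[a == ordS c]val_eqE /=.
    have [ac|ca|ac] := ltngtP a c.
    (* At the last index [ordS] wraps around to 0, which accounts for the closing edge. *)
    * have [ecb|ncb] := eqVneq (c : nat) b.
        rewrite ecb modnn; have [ea|na] := eqVneq (a : nat) 0%N.
          by rewrite ea hQ.
        by rewrite noF // ?na; lia.
      by rewrite noF ?ncb ?orbT // modn_small; [apply/esym/eqP; lia|lia].
    * rewrite modn_small; last by lia.
      have [->|na] := eqVneq (a : nat) c.+1.
        by apply: BQ; apply: hB; lia.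
      by rewrite noB; lia.
    * by rewrite ac; apply: AQ; apply: hA; lia.
- by move=> i; apply: hA; rewrite -ltnS.
(* Since [b] is positive, index 0 is not the last one, so its second edge belongs to the walk and
   lies in [B]. *)
- have b1 : (0 < b.+1)%N by [].
  by exists (Ordinal b1); rewrite /= modn_small //; apply: hB.
Qed.

(** A walk alternating between [A] and [B] never gets stuck, and by finiteness it revisits a vertex
    of [T1]; the part between the two visits is a closed walk. *)
Lemma exists_alternating_cycle A B (j0 : T1) (k0 : T2) :
  (forall j k, A j k -> Q j k) -> (forall j k, B j k -> Q j k) ->
  (forall j k, A j k -> B j k -> False) ->
  (forall j k, A j k -> exists j', B j' k) ->
  (forall j k, B j k -> exists k', A j k') ->
  A j0 k0 -> alternating_cycle A B \/ alternating_cycle B A.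
Proof.
move=> AQ BQ dAB AB BA A0.
(* The default [p] is never reached from an edge of [A], as [stepP] shows. *)
pose step (p : T1 * T2) :=
  odflt p [pick p' : T1 * T2 | B p'.1 p.2 && A p'.1 p'.2].
have stepP p : A p.1 p.2 -> B (step p).1 p.2 /\ A (step p).1 (step p).2.
  move=> Ap; rewrite /step; case: pickP => [p' /andP[]//|nop].
  have [j Bj] := AB _ _ Ap; have [k Ak] := BA _ _ Bj.
  by move: (nop (j, k)); rewrite /= Bj Ak.
pose p i := iter i step (j0, k0).
have pA i : A (p i).1 (p i).2.
  by elim: i => [|i IH] //=; case: (stepP _ IH).
have pB i : B (p i.+1).1 (p i).2 by case: (stepP _ (pA i)).
have [a [c [ac e]]] : exists a c, (a < c)%N /\ (p a).1 = (p c).1.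
  pose f (i : 'I_#|T1|.+1) := (p i).1.
  have /injectivePn[x [y nxy fxy]] : ~~ injectiveb f.
    apply/negP => /injectiveP /leq_card; by rewrite card_ord ltnn.
  case: (ltngtP x y) => h.
  - by exists x, y.
  - by exists y, x.
  - by case/eqP: nxy; apply: val_inj.
(* Otherwise the edge at index [a] would lie in both [A] and [B]. *)
have ca : a != c.-1.
  apply/eqP => ca; apply: (dAB _ _ (pA a)).
  by move: (pB c.-1); rewrite (ltn_predK ac) -e -ca.
(* The walk stops at index [c.-1]: the [B]-edge from there to the repeated vertex is the closing
   edge. *)
apply: (@closed_walk_cycle (c.-1 - a)%N A B (fun i => (p (a + i)%N).1)
          (fun i => (p (a + i)%N).2)) => //.
- by lia.
- by move=> i _; rewrite addnS.
- rewrite addn0 e subnKC; last by lia.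
  by apply: BQ; rewrite -{1}(ltn_predK ac).
Qed.

End InducedCycles.

(** * The kernel of phi_Q and the binomials of H_Q *)

Lemma sum_gt0P N (P : pred 'I_N) (m : 'X_{1..N}) :
  reflect (exists2 q, P q & (0 < m q)%N) (0 < \sum_(q | P q) m q)%N.
Proof.
rewrite lt0n sum_nat_eq0 negb_forall; apply: (iffP existsP) => [[q]|[q Pq mq]].
  by rewrite negb_imply => /andP[Pq mq]; exists q; rewrite // lt0n.
by exists q; rewrite negb_imply Pq -lt0n.
Qed.

Section ToricIdeal.
Variables (K : fieldType) (r s : nat) (Q : {set 'I_r * 'I_s}).
Local Notation N := #|Q|.
Local Notation zidx := (@zidx r s Q).
Local Notation zvar := (@zvar K r s Q).
Local Notation phiQ := (@phiQ K r s Q).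
Local Notation HQ := (@HQ K r s Q).
Implicit Types (m : 'X_{1..N}) (q : 'I_N).

Lemma zidx_inj : injective zidx.
Proof. exact: enum_val_inj. Qed.

Lemma zidxP q : ((zidx q).1, (zidx q).2) \in Q.
Proof. by rewrite -surjective_pairing; apply: enum_valP. Qed.

Lemma zidx_onto j k : (j, k) \in Q -> exists q, zidx q = (j, k).
Proof.
by move=> jkQ; exists (enum_rank_in jkQ (j, k)); rewrite /Defs.zidx enum_rankK_in.
Qed.

Lemma zvarE j k q : zidx q = (j, k) -> zvar j k = 'X_q.
Proof.
move=> qE; rewrite /Defs.zvar; case: pickP => [q' /eqP|/(_ q)].
  by rewrite -qE => /zidx_inj ->.
by rewrite qE eqxx.
Qed.

(** This is the column of B_Q with index [q], so that [tmon] is multiplication of exponent vectors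
    by B_Q. *)
Definition edge_mnm q : 'X_{1..r + s} :=
  (U_(lshift s (zidx q).1) + U_(rshift r (zidx q).2))%MM.
Definition tmon m : 'X_{1..r + s} := msubst edge_mnm m.

Lemma phiQE p : phiQ p = \sum_(m <- msupp p) p@_m *: 'X_[tmon m].
Proof. by apply: mmap_msubst => q; rewrite -mpolyXD. Qed.

Lemma mcoeff_phiQ p t : (phiQ p)@_t = lin (fun m => (tmon m == t)%:R) p.
Proof.
rewrite phiQE raddf_sum; apply: eq_bigr => m _.
by rewrite /= mcoeffZ mcoeffX.
Qed.

Lemma phiQX m : phiQ 'X_[m] = 'X_[tmon m].
Proof. by rewrite phiQE msuppX big_seq1 mcoeffX eqxx scale1r. Qed.

Lemma phiQB : {morph phiQ : p q / p - q}.
Proof. exact: rmorphB. Qed.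

Lemma phiQZ c p : phiQ (c *: p) = c *: phiQ p.
Proof. by rewrite /Defs.phiQ mmapZ mul_mpolyC. Qed.

Lemma edge_mnm_l q j : edge_mnm q (lshift s j) = ((zidx q).1 == j).
Proof. by rewrite mnmDE !mnm1E eq_lshift eq_rlshift addn0. Qed.

Lemma edge_mnm_r q k : edge_mnm q (rshift r k) = ((zidx q).2 == k).
Proof. by rewrite mnmDE !mnm1E eq_rshift eq_lrshift. Qed.

(** If [m] is read as a multiset of edges of G_Q, then [tmon m] records the degrees of the
    vertices. *)
Lemma tmon_l m j : tmon m (lshift s j) = (\sum_(q | (zidx q).1 == j) m q)%N.
Proof.
rewrite /tmon mnm_sumE [RHS]big_mkcond; apply: eq_bigr => q _ /=.
by rewrite mulmnE edge_mnm_l; case: eqP; rewrite ?mul1n.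
Qed.

Lemma tmon_r m k : tmon m (rshift r k) = (\sum_(q | (zidx q).2 == k) m q)%N.
Proof.
rewrite /tmon mnm_sumE [RHS]big_mkcond; apply: eq_bigr => q _ /=.
by rewrite mulmnE edge_mnm_r; case: eqP; rewrite ?mul1n.
Qed.

Lemma mdeg_tmon m : mdeg (tmon m) = (mdeg m).*2.
Proof.
rewrite mdeg_sum mdegE -addnn -big_split /=; apply: eq_bigr => q _.
by rewrite mdegMn mdegD !mdeg1 mulSn mul1n.
Qed.

(** All edges of the cycle lie in [Q], so [zvar] never takes its default value 0 and both products
    are monomials. *)
Lemma HQ_binomial l (js : 'I_l -> 'I_r) (ks : 'I_l -> 'I_s) :
  induced_cycle (adjx Q) js ks ->
  exists2 qs : ('I_l -> 'I_N) * ('I_l -> 'I_N),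
    (forall i, zidx (qs.1 i) = (js i, ks i) /\
               zidx (qs.2 i) = (js (ordS i), ks i)) &
    \prod_(i < l) zvar (js i) (ks i) - \prod_(i < l) zvar (js (ordS i)) (ks i)
    = 'X_[\sum_i U_(qs.1 i)] - 'X_[\sum_i U_(qs.2 i)].
Proof.
case=> l2 injj injk adj.
have /fin_all_exists[q1 h1] i : exists q, zidx q = (js i, ks i).
  by apply: zidx_onto; rewrite -/(adjx Q _ _) adj eqxx.
have /fin_all_exists[q2 h2] i : exists q, zidx q = (js (ordS i), ks i).
  by apply: zidx_onto; rewrite -/(adjx Q _ _) adj eqxx orbT.
exists (q1, q2) => [//|] /=.
rewrite -!mprodXE; congr (_ - _); apply: eq_bigr => i _; exact: zvarE.
Qed.

(** Both halves of the cycle meet the same vertices, since [ordS] only permutes the indices. *)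
Lemma tmon_cycle l (js : 'I_l -> 'I_r) (ks : 'I_l -> 'I_s) (q1 q2 : 'I_l -> 'I_N) :
  (forall i, zidx (q1 i) = (js i, ks i) /\ zidx (q2 i) = (js (ordS i), ks i)) ->
  tmon (\sum_i U_(q1 i))%MM = tmon (\sum_i U_(q2 i))%MM.
Proof.
move=> h; rewrite /tmon !msubst_sum.
under eq_bigr do rewrite msubstU /edge_mnm (h _).1.
under [RHS]eq_bigr do rewrite msubstU /edge_mnm (h _).2.
rewrite !big_split /=; congr (_ + _)%MM.
by rewrite [LHS](reindex_inj (@ordS_inj l)).
Qed.

Lemma tmonD m1 m2 : tmon (m1 + m2)%MM = (tmon m1 + tmon m2)%MM.
Proof. exact: msubstD. Qed.

Lemma alternating_step m m' : tmon m = tmon m' ->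
  alternating_cycle (adjx Q)
    (fun j k => [exists q, (zidx q == (j, k)) && (0 < m q)%N])
    (fun j k => [exists q, (zidx q == (j, k)) && (0 < m' q)%N]) ->
  exists m'', [/\ tmon m'' = tmon m, ideal_gen HQ ('X_[m] - 'X_[m'']) &
                  exists2 q, (0 < m'' q)%N & (0 < m' q)%N].
Proof.
move=> tmm' [l [js [ks [ind hA [i0 hB]]]]].
have [[q1 q2] /= hq bin] := HQ_binomial ind.
(* Distinct edges make [m1] squarefree, so it divides [m] as soon as each of its variables does. *)
have q1_inj : injective q1.
  move=> i i' e; case: ind => _ injj _ _; apply: injj.
  by have := (hq i).1; rewrite e (hq i').1 => -[->].
set m1 := (\sum_i U_(q1 i))%MM in bin *; set m2 := (\sum_i U_(q2 i))%MM in bin *.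
have le1 : (m1 <= m)%MM.
  apply/mnm_lepP => q; rewrite mnm_sumE.
  have [/existsP[i /eqP iq]|/existsPn nq] := boolP [exists i, q1 i == q].
    rewrite (bigD1 i) //= mnm1E iq eqxx big1 => [|i' ni]; last first.
      by rewrite mnm1E -iq (inj_eq q1_inj) (negPf ni).
    rewrite addn0; have /existsP[q' /andP[/eqP e mq']] := hA i.
    by move: e; rewrite -(hq i).1 => /zidx_inj e; rewrite -iq -e.
  by rewrite big1 // => i _; rewrite mnm1E (negPf (nq i)).
(* The [m1]-half of the cycle is exchanged for the [m2]-half, which contains an edge of [m']. *)
exists (m - m1 + m2)%MM; split.
- by rewrite tmonD -(tmon_cycle hq) -tmonD submK.
- rewrite -{1}(submK le1) !mpolyXD -mulrBr.
  have [_ _] := ideal_gen_ideal HQ; apply; apply: mem_ideal_gen.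
  case: ind => l2 injj injk adj.
  by exists l, js, ks; split=> //; rewrite bin.
- have /existsP[q /andP[/eqP e m'q]] := hB; exists q => //.
  move: e; rewrite -(hq i0).2 => /zidx_inj ->.
  rewrite mnmDE mnm_sumE (bigD1 i0) //= mnm1E eqxx; lia.
Qed.

Lemma binomial_in_HQ m m' : tmon m = tmon m' -> ideal_gen HQ ('X_[m] - 'X_[m']).
Proof.
have idH := ideal_gen_ideal HQ; have [I0 ID IM] := idH.
have deg_eq a b : tmon a = tmon b -> mdeg a = mdeg b.
  by move=> e; apply: double_inj; rewrite -!mdeg_tmon e.
elim: {m}(mdeg m) {-2}m m' (erefl (mdeg m)) => [|d IH] m m' dm tmm'.
  move/eqP: (dm); rewrite mdeg_eq0 => /eqP ->.
  move/eqP: dm; rewrite (deg_eq _ _ tmm') mdeg_eq0 => /eqP ->.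
  by rewrite subrr.
have common a b q : mdeg a = d.+1 -> tmon a = tmon b -> (0 < a q)%N -> (0 < b q)%N ->
    ideal_gen HQ ('X_[a] - 'X_[b]).
  move=> da tab aq bq.
  have la : (U_(q) <= a)%MM by rewrite lep1mP -lt0n.
  have lb : (U_(q) <= b)%MM by rewrite lep1mP -lt0n.
  move: da tab; rewrite -{1 2 3}(submK la) -{1 2}(submK lb) !tmonD mdegD mdeg1 addn1.
  move=> [da] /addIm tab; rewrite !mpolyXD -mulrBl mulrC; apply: IM.
  exact: IH.
pose A (a : 'X_{1..N}) j k := [exists q, (zidx q == (j, k)) && (0 < a q)%N].
have AQ a j k : A a j k -> adjx Q j k.
  by case/existsP => q /andP[/eqP e _]; move: (zidxP q); rewrite e.
(* The exchange yields some [c] that shares a variable with [b], and a - b = (a - c) + (c - b). *)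
have step a b : mdeg a = d.+1 -> tmon a = tmon b ->
    alternating_cycle (adjx Q) (A a) (A b) -> ideal_gen HQ ('X_[a] - 'X_[b]).
  move=> da tab /(alternating_step tab) [c [tc hac [q cq bq]]].
  rewrite -(subrK 'X_[c] 'X_[a]) -addrA; apply: (ID) => //.
  by apply: (common _ _ q) => //; rewrite ?tc // (deg_eq _ _ tc).
have [/existsP[q /andP[mq m'q]]|nc] := boolP [exists q, (0 < m q)%N && (0 < m' q)%N].
  exact: (common _ _ q).
have [q0 mq0] : exists q, (0 < m q)%N.
  have : (0 < \sum_(q | true) m q)%N by rewrite -mdegE dm.
  by case/sum_gt0P => q _ mq; exists q.
suff [h|h] : alternating_cycle (adjx Q) (A m) (A m') \/
             alternating_cycle (adjx Q) (A m') (A m).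
- exact: step.
- by apply: ideal_subC => //; apply: step => //; rewrite -(deg_eq _ _ tmm').
apply: (@exists_alternating_cycle _ _ _ _ _ (zidx q0).1 (zidx q0).2) => //; try exact: AQ.
- move=> j k /existsP[q /andP[/eqP e mq]] /existsP[q' /andP[/eqP e' mq']].
  move: e'; rewrite -e => /zidx_inj e'; subst q'.
  by move/existsPn: nc => /(_ q); rewrite mq mq'.
(* Equal images mean equal vertex degrees, so a vertex met by an edge of one monomial is met by an
   edge of the other. *)
- move=> j k /existsP[q /andP[/eqP e mq]].
  have : (0 < tmon m (rshift r k))%N.
    by rewrite tmon_r; apply/sum_gt0P; exists q; rewrite ?e /=.
  rewrite tmm' tmon_r => /sum_gt0P[q' /eqP e' mq'].
  by exists (zidx q').1; apply/existsP; exists q'; rewrite mq' -e' -surjective_pairing eqxx.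
- move=> j k /existsP[q /andP[/eqP e mq]].
  have : (0 < tmon m' (lshift s j))%N.
    by rewrite tmon_l; apply/sum_gt0P; exists q; rewrite ?e /=.
  rewrite -tmm' tmon_l => /sum_gt0P[q' /eqP e' mq'].
  by exists (zidx q').2; apply/existsP; exists q'; rewrite mq' -e' -surjective_pairing eqxx.
- by apply/existsP; exists q0; rewrite mq0 -surjective_pairing eqxx.
Qed.

(* Monomials whose image survives in phiQ g lie in L by hypothesis; the others
   cancel in pairs with the same image, whose differences lie in <HQ>. *)
Lemma ideal_of_phiQ (L : {mpoly K[N]} -> Prop) g : is_ideal L ->
  (forall h, HQ h -> L h) ->
  (forall m, tmon m \in msupp (phiQ g) -> L 'X_[m]) -> L g.
Proof.
move=> idL HL; have [L0 LD _] := idL.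
elim: {g}(size (msupp g)) {-2}g (leqnn (size (msupp g))) => [|n IH] g.
  by rewrite leqn0 size_eq0 msupp_eq0 => /eqP ->.
move=> sg hg; have [->//|g0] := eqVneq g 0.
have [m mg] : exists m, m \in msupp g by exists (mlead g); apply: mlead_supp.
(* Subtracting such an [h] removes [m] from the support and adds no new monomial. *)
have shrink h : g@_m = h@_m -> {subset msupp h <= msupp g} ->
    (size (msupp (g - h)) <= n)%N.
  move=> gh sub; rewrite -ltnS; apply: leq_trans sg.
  have -> : size (msupp g) = (size (rem m (msupp g))).+1.
    by rewrite size_rem // prednK // -has_predT; apply/hasP; exists m.
  rewrite ltnS; apply: uniq_leq_size => // m' m'gh.
  rewrite mem_rem_uniq ?msupp_uniq // !inE; apply/andP; split.
    by apply/eqP => m'm; move: m'gh; rewrite m'm mcoeff_msupp mcoeffB gh subrr eqxx.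
  by move/msuppB_le: m'gh; rewrite mem_cat => /orP[//|/sub].
have gm0 : g@_m != 0 by rewrite -mcoeff_msupp.
suff [h [Lh gh sub supp]] : exists h, [/\ L h, g@_m = h@_m,
    {subset msupp h <= msupp g} &
    {subset msupp (phiQ (g - h)) <= msupp (phiQ g)}].
  rewrite -(subrK h g); apply: (LD) => //; apply: IH => [|m' /supp]; first exact: shrink.
  exact: hg.
have [tm|tm] := boolP (tmon m \in msupp (phiQ g)).
  exists (g@_m *: 'X_[m]); split.
  - by apply: idealZ => //; apply: hg.
  - by rewrite mcoeffZ mcoeffX eqxx mulr1.
  - by move=> m'; rewrite msuppMCX // inE => /eqP ->.
  - move=> t; rewrite phiQB => /msuppB_le; rewrite mem_cat => /orP[//|].
    by rewrite phiQE msuppMCX // big_seq1 => /msuppZ_le; rewrite msuppX inE => /eqP ->.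
have [m' m'g /andP[nm /eqP tm']] : exists2 m', m' \in msupp g & (m' != m) && (tmon m' == tmon m).
  apply/hasP; apply: contraNT gm0 => /hasPn no.
  move/memN_msupp_eq0: tm; rewrite mcoeff_phiQ /lin (bigD1_seq m) //= eqxx mulr1.
  rewrite big_seq_cond big1 ?addr0 => [->//|m' /andP[m'g nm]].
  by move: (no _ m'g); rewrite nm /= => /negPf ->; rewrite mulr0.
exists (g@_m *: ('X_[m] - 'X_[m'])); split.
- apply: idealZ => //; apply: (ideal_gen_min idL HL); exact: binomial_in_HQ.
- by rewrite mcoeffZ mcoeffB !mcoeffX eqxx (negPf nm) subr0 mulr1.
- move=> x /msuppZ_le /msuppB_le; rewrite !msuppX !inE => /orP[]/eqP -> //.
- by move=> t; rewrite phiQB phiQZ phiQB !phiQX tm' subrr scaler0 subr0.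
Qed.

End ToricIdeal.

(** * Normal forms modulo a Gröbner basis *)

Lemma msupp_bigP (K : fieldType) n (T : eqType) (s : seq T)
    (h : T -> {mpoly K[n]}) m :
  m \in msupp (\sum_(i <- s) h i) -> exists2 i, i \in s & m \in msupp (h i).
Proof.
elim: s => [|i s IH]; first by rewrite big_nil msupp0.
rewrite big_cons => /msuppD_le; rewrite mem_cat => /orP[mi|/IH[j js mj]].
  by exists i; rewrite ?inE ?eqxx.
by exists j; rewrite // inE js orbT.
Qed.

Lemma msuppMXP (K : fieldType) n (p : {mpoly K[n]}) a m :
  m \in msupp (p * 'X_[a]) -> exists2 m', m' \in msupp p & m = (a + m')%MM.
Proof. by rewrite (perm_mem (msuppMX _ _)) => /mapP. Qed.

Section NormalForms.
Variables (K : fieldType) (R : realFieldType) (n : nat) (w : 'rV[R]_n).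
Variables (F : seq {mpoly K[n]}) (I : {mpoly K[n]} -> Prop).
Implicit Types (f g p : {mpoly K[n]}) (a m : 'X_{1..n}).

Definition reducible a : Prop := exists f c m,
  [/\ f \in F, c != 0, init_form w f = c *: 'X_[m] & (m <= a)%MM].

Hypothesis idI : is_ideal I.
Hypothesis GB : is_GB w F I.
Hypothesis homF : forall f, f \in F -> exists d, is_homog d f.

(** One division step replaces the leading term of a multiple of [f] by its tail. The degree is kept
    because [f] is homogeneous, and the weight drops because the initial form is a monomial. *)
Lemma reduction a : reducible a -> exists p, I ('X_[a] - p) /\
  forall m, m \in msupp p -> mdeg m = mdeg a /\ mwt w m < mwt w a.
Proof.
case=> f [c [m [fF c0 inf lem]]].
have [mf fm lt_m] := init_form_monomial c0 inf.
have [d /allP hd] := homF fF.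
have [[_ FI _] _] := GB; have [_ _ IM] := idI.
exists ('X_[a] - c^-1 *: ('X_[a - m] * f)); split.
  by rewrite subKr; apply: idealZ => //; apply: IM; apply: FI.
have -> : 'X_[a] - c^-1 *: ('X_[a - m] * f) =
          - c^-1 *: ((f - c *: 'X_[m]) * 'X_[a - m]).
  rewrite mulrBl -scalerAl -mpolyXD addmC submK // scalerBr scalerA mulNr.
  by rewrite mulVf // scaleN1r opprK scaleNr addrC [f * _]mulrC.
move=> x /msuppZ_le /msuppMXP[y yf ->].
have ym : y != m.
  apply: contraTneq yf => ->.
  by rewrite mcoeff_msupp mcoeffB mcoeffZ mcoeffX eqxx mulr1 fm subrr eqxx.
have {}yf : y \in msupp f.
  move/msuppB_le: yf; rewrite mem_cat msuppMCX // inE (negPf ym) orbF //.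
split; first by rewrite mdegD (eqP (hd y yf)) -(eqP (hd m mf)) -mdegD submK.
by rewrite -[X in _ < mwt w X](submK lem) !mwtD ltrD2l; apply: lt_m.
Qed.

(** The last clause records the strict drop of weight, which later confines the support of the dual
    functionals. *)
Definition normal_form a p : Prop :=
  [/\ forall m, m \in msupp p -> ~ reducible m, I ('X_[a] - p) &
      (~ reducible a /\ p = 'X_[a]) \/
      (reducible a /\ forall m, m \in msupp p -> mwt w m < mwt w a)].

(** One normal form is chosen per monomial; [inhabits 0] only shows the type to be inhabited, and
    existence is the content of [nfP]. *)
Definition nf a : {mpoly K[n]} := epsilon (inhabits 0) (normal_form a).

Lemma nfP a : normal_form a (nf a).
Proof.
(* All monomials produced by a reduction have the degree of [a], hence there
   are finitely many of them, so that reduction terminates for any weight. *)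
pose below d a := #|[set x : 'X_{1..n < d.+1} | mwt w x < mwt w a]|.
move: {2}(below _ a) (leqnn (below (mdeg a) a)) => k.
elim/ltn_ind: k a => k IH a ka.
apply: epsilon_spec; have [I0 ID _] := idI.
have [ra|nra] := classic (reducible a); last first.
  exists 'X_[a]; split; last by left.
    by move=> m; rewrite msuppX inE => /eqP ->.
  by rewrite subrr.
have [p [Ip hp]] := reduction ra.
have nfp m : m \in msupp p -> normal_form m (nf m).
  move=> /hp[dm wm]; apply: (IH (below (mdeg m) m)) => //; apply: leq_trans ka.
  (* The monomials below [m] form a proper subset of those below [a], as [m] belongs only to the
     latter. *)
  rewrite dm; apply: proper_card; apply/properP; split.
    by apply/subsetP => x; rewrite !inE => /lt_trans; apply.
  have dma : (mdeg m < (mdeg a).+1)%N by rewrite dm.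
  by exists (BMultinom dma); rewrite !inE //= ltxx.
exists (\sum_(m <- msupp p) p@_m *: nf m); split.
- by move=> m /msupp_bigP[m' /nfp[nr _ _]] /msuppZ_le /nr.
- rewrite -(subrK p 'X_[a]) -addrA; apply: ID => //.
  rewrite {1}[p]mpolyE -sumrB; apply: ideal_big => // m /nfp[_ Im _].
  by rewrite -scalerBr; apply: idealZ.
- right; split=> // m /msupp_bigP[m' m'p] /msuppZ_le mm'.
  have [_ wm'] := hp _ m'p; case: (nfp _ m'p) => _ _ [[_ e]|[_ h]].
    by move: mm'; rewrite e msuppX inE => /eqP ->.
  exact: lt_trans (h _ mm') wm'.
Qed.

(** The initial form of a nonzero [f] in [I] lies in the ideal generated by the leading monomials of
    [F], so each of its monomials is divisible by one of them. *)
Lemma irreducible_eq0 f : I f -> (forall m, m \in msupp f -> ~ reducible m) -> f = 0.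
Proof.
move=> If irr; apply/eqP/negPn/negP => /(init_form_neq0 w)[m min].
have [[_ _ gen] lead] := GB.
have /gen[l [hl e]] : init_ideal w I (init_form w f).
  by apply: mem_ideal_gen; exists f.
have : m \in msupp f by move: min; rewrite msupp_init_form => /andP[].
move/irr; apply; move: min; rewrite e => /msupp_bigP[p /hl[g gF ->]].
have [c [m0 [c0 ing]]] := lead g gF.
rewrite ing -scalerAr => /msuppZ_le /msuppMXP[m' _ ->].
by exists g, c, m0; split=> //; apply: lem_addr.
Qed.

(** The functional takes the coefficient of [a0] in the normal form. It kills [I] because the normal
    form of an element of [I] lies in [I] and is irreducible, hence zero. *)
Lemma dual_functional a0 : ~ reducible a0 -> exists alpha : 'X_{1..n} -> K,
  [/\ alpha a0 = 1, forall a, alpha a != 0 -> a = a0 \/ mwt w a0 < mwt w a &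
      forall f, I f -> lin alpha f = 0].
Proof.
move=> irr; exists (fun a => (nf a)@_a0); split.
- by case: (nfP a0) => _ _ [[_ ->]|[]//]; rewrite mcoeffX eqxx.
- move=> a; rewrite -mcoeff_msupp; case: (nfP a) => _ _ [[_ ->]|[_ h /h]]; last by right.
  by rewrite msuppX inE => /eqP ->; left.
- move=> f If; have -> : lin (fun a => (nf a)@_a0) f
                         = (\sum_(m <- msupp f) f@_m *: nf m)@_a0.
    by rewrite raddf_sum; apply: eq_bigr => m _; rewrite /= mcoeffZ.
  rewrite [X in X@__]irreducible_eq0 ?mcoeff0 //; last first.
    by move=> m /msupp_bigP[m' _] /msuppZ_le; case: (nfP m') => h _ _ /h.
  rewrite -[X in I X](subKr f); apply: idealB => //.
  rewrite {1}[f]mpolyE -sumrB; apply: ideal_big => // m _.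
  by rewrite -scalerBr; apply: idealZ => //; case: (nfP m).
Qed.

End NormalForms.

(** * The ideal I + J and products of functionals *)

Section IdealSum.
Variables (K : fieldType) (R : realFieldType) (r s : nat).
Variables (w1 : 'rV[R]_r) (w2 : 'rV[R]_s).
Variables (I : {mpoly K[r]} -> Prop) (J : {mpoly K[s]} -> Prop).
Variables (F : seq {mpoly K[r]}) (G : seq {mpoly K[s]}).

Definition lmnm (t : 'X_{1..r + s}) : 'X_{1..r} := [multinom t (lshift s j) | j < r].
Definition rmnm (t : 'X_{1..r + s}) : 'X_{1..s} := [multinom t (rshift r k) | k < s].

Lemma lmnmD t u : lmnm (t + u)%MM = (lmnm t + lmnm u)%MM.
Proof. by apply/mnmP => j; rewrite !mnmE. Qed.

Lemma rmnmD t u : rmnm (t + u)%MM = (rmnm t + rmnm u)%MM.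
Proof. by apply/mnmP => j; rewrite !mnmE. Qed.

Lemma lrmnm_inj t u : lmnm t = lmnm u -> rmnm t = rmnm u -> t = u.
Proof.
move=> /mnmP l /mnmP e; apply/mnmP => i; case: (split_ordP i) => j ->.
  by move: (l j); rewrite !mnmE.
by move: (e j); rewrite !mnmE.
Qed.

Lemma mwt_row_mx t : mwt (row_mx w1 w2) t = mwt w1 (lmnm t) + mwt w2 (rmnm t).
Proof.
rewrite /mwt big_split_ord /=; congr (_ + _); apply: eq_bigr => i _.
  by rewrite row_mxEl mnmE.
by rewrite row_mxEr mnmE.
Qed.

Local Notation jx := (msubst (fun j : 'I_r => U_(lshift s j)%MM)).
Local Notation jy := (msubst (fun k : 'I_s => U_(rshift r k)%MM)).

Lemma lmnm_jx m : lmnm (jx m) = m.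
Proof.
apply/mnmP => j; rewrite mnmE mnm_sumE (bigD1 j) //= mulmnE mnm1E eqxx mul1n.
rewrite big1 ?addn0 // => i ij; rewrite mulmnE mnm1E.
by rewrite (inj_eq (@lshift_inj _ _)) (negPf ij).
Qed.

Lemma rmnm_jx m : rmnm (jx m) = 0%MM.
Proof.
apply/mnmP => k; rewrite mnmE mnm0E mnm_sumE big1 // => i _.
by rewrite mulmnE mnm1E eq_lrshift.
Qed.

Lemma rmnm_jy m : rmnm (jy m) = m.
Proof.
apply/mnmP => j; rewrite mnmE mnm_sumE (bigD1 j) //= mulmnE mnm1E eqxx mul1n.
rewrite big1 ?addn0 // => i ij; rewrite mulmnE mnm1E.
by rewrite (inj_eq (@rshift_inj _ _)) (negPf ij).
Qed.

Lemma lmnm_jy m : lmnm (jy m) = 0%MM.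
Proof.
apply/mnmP => k; rewrite mnmE mnm0E mnm_sumE big1 // => i _.
by rewrite mulmnE mnm1E eq_rlshift.
Qed.

Lemma incxE (f : {mpoly K[r]}) : incx s f = \sum_(m <- msupp f) f@_m *: 'X_[jx m].
Proof. exact: mmap_msubst. Qed.

Lemma incyE (g : {mpoly K[s]}) : incy r g = \sum_(m <- msupp g) g@_m *: 'X_[jy m].
Proof. exact: mmap_msubst. Qed.

Lemma lin_mul_sum n N (gamma : 'X_{1..N} -> K) (j : 'X_{1..n} -> 'X_{1..N})
    (f : {mpoly K[n]}) (p : {mpoly K[N]}) :
  lin gamma (p * \sum_(m <- msupp f) f@_m *: 'X_[j m]) =
  \sum_(a <- msupp p) p@_a * lin (fun m => gamma (a + j m)%MM) f.
Proof.
rewrite {1}[p]mpolyE mulr_suml.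
under eq_bigr do rewrite -scalerAl.
rewrite lin_sum; apply: eq_bigr => a _; congr (_ * _).
rewrite mulr_sumr; under eq_bigr do rewrite -scalerAr -mpolyXD.
by rewrite lin_sum; apply: eq_bigr => m _; rewrite linX.
Qed.

Lemma lin_mulX n (alpha : 'X_{1..n} -> K) a (f : {mpoly K[n]}) :
  lin (fun m => alpha (a + m)%MM) f = lin alpha ('X_[a] * f).
Proof.
by rewrite {2}[f]mpolyE lin_mul_sum msuppX big_seq1 mcoeffX eqxx mul1r.
Qed.

Lemma linZ n (alpha : 'X_{1..n} -> K) c (f : {mpoly K[n]}) :
  lin (fun m => c * alpha m) f = c * lin alpha f.
Proof. by rewrite /lin mulr_sumr; apply: eq_bigr => m _; rewrite mulrCA. Qed.

(** On a monomial multiple of an element of [I] the y-exponent is constant, so the product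
    functional is a scalar times [alpha] on an element of [I]. The case of [J] is symmetric. *)
Lemma lin_ideal_sum (alpha : 'X_{1..r} -> K) (beta : 'X_{1..s} -> K) h :
  is_ideal I -> is_ideal J ->
  (forall f, I f -> lin alpha f = 0) -> (forall g, J g -> lin beta g = 0) ->
  ideal_sum I J h -> lin (fun t => alpha (lmnm t) * beta (rmnm t)) h = 0.
Proof.
move=> [_ _ IM] [_ _ JM] aI bJ [l [hl ->]].
have -> : \sum_(p <- l) p.1 * p.2 = \sum_(p <- l) 1 *: (p.1 * p.2).
  by apply: eq_bigr => p _; rewrite scale1r.
rewrite lin_sum big_seq big1 // => -[p q] /hl /= [[f If ->]|[g Jg ->]]; rewrite mul1r.
  rewrite incxE lin_mul_sum big1 // => a _.
  rewrite (@eq_lin _ _ _ (fun m => beta (rmnm a) * alpha (lmnm a + m)%MM)).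
    by rewrite linZ lin_mulX aI ?mulr0 //; apply: IM.
  by move=> m; rewrite lmnmD rmnmD lmnm_jx rmnm_jx addm0 mulrC.
rewrite incyE lin_mul_sum big1 // => a _.
rewrite (@eq_lin _ _ _ (fun m => alpha (lmnm a) * beta (rmnm a + m)%MM)).
  by rewrite linZ lin_mulX bJ ?mulr0 //; apply: JM.
by move=> m; rewrite lmnmD rmnmD lmnm_jy rmnm_jy addm0.
Qed.

(** Were both parts irreducible, the product of the dual functionals would pick out the coefficient
    of [t] in [h]: any other monomial on which it is nonzero outweighs [t]. *)
Lemma reducible_ideal_sum h t :
  is_ideal I -> is_ideal J -> is_GB w1 F I -> is_GB w2 G J ->
  (forall f, f \in F -> exists d, is_homog d f) ->
  (forall g, g \in G -> exists d, is_homog d g) ->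
  ideal_sum I J h -> t \in msupp h -> topw (row_mx w1 w2) h t ->
  reducible w1 F (lmnm t) \/ reducible w2 G (rmnm t).
Proof.
move=> idI idJ GBF GBG homF homG hIJ th /allP top; apply: NNPP => /not_or_and[nF nG].
have [alpha [a1 a2 aI]] := dual_functional idI GBF homF nF.
have [beta [b1 b2 bJ]] := dual_functional idJ GBG homG nG.
have := lin_ideal_sum idI idJ aI bJ hIJ; apply/eqP.
rewrite /lin (bigD1_seq t) //= a1 b1 !mulr1 big_seq_cond big1 ?addr0.
  by rewrite -mcoeff_msupp.
move=> u /andP[uh ut]; apply/eqP; rewrite !mulf_eq0; apply: contraT.
rewrite !negb_or => /and3P[_ /a2 ha /b2 hb].
have := top u uh; rewrite !mwt_row_mx; case: ha => [ha|ha]; case: hb => [hb|hb].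
- by move/eqP: ut; rewrite (lrmnm_inj ha hb).
- by rewrite ha lerD2l leNgt hb.
- by rewrite hb lerD2r leNgt ha.
- by rewrite leNgt ltrD.
Qed.

End IdealSum.

(** * Finiteness of sets given by predicates *)

Section FiniteSets.
Variable T : eqType.
Implicit Types P S : T -> Prop.

(** As [P] need not be decidable, the enumeration is filtered by excluded middle, one element at a
    time. *)
Lemma finite_set_sub P S :
  finite_set S -> (forall x, P x -> S x) -> finite_set P.
Proof.
move=> [s hs] PS.
suff [s' hs'] : exists s' : seq T, forall x, x \in s' <-> P x /\ x \in s.
  by exists s' => x; rewrite hs'; split=> [Px|[]//]; split=> //; apply: (hs x).1; apply: PS.
elim: {hs} s => [|y s [s' IH]]; first by exists [::] => x; split=> // -[].
have [Py|nPy] := classic (P y).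
  exists (y :: s') => x; rewrite !inE; split.
    by case/orP => [/eqP ->|/IH[Px ->]]; rewrite ?eqxx ?orbT.
  by case=> Px /orP[->//|xs]; apply/orP; right; apply/IH.
exists s' => x; rewrite inE; split=> [/IH[Px ->]|[Px /orP[/eqP xy|xs]]].
- by rewrite orbT.
- by case: nPy; rewrite -xy.
- exact/IH.
Qed.

Lemma finite_setU P S :
  finite_set P -> finite_set S -> finite_set (fun x => P x \/ S x).
Proof.
move=> [s hs] [s' hs']; exists (s ++ s') => x; rewrite mem_cat hs hs'.
by split=> /orP.
Qed.

Lemma finite_set_bigU (U : eqType) (l : seq U) (P : U -> T -> Prop) :
  (forall i, i \in l -> finite_set (P i)) ->
  finite_set (fun x => exists2 i, i \in l & P i x).
Proof.
elim: l => [|i l IH] h; first by exists [::] => x; split=> // -[].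
have hi : finite_set (P i) by apply: h; rewrite inE eqxx.
have hl : finite_set (fun x => exists2 i, i \in l & P i x).
  by apply: IH => j jl; apply: h; rewrite inE jl orbT.
apply: finite_set_sub (finite_setU hi hl) _ => x [j].
by rewrite inE => /orP[/eqP ->|jl] Pj; [left|right; exists j].
Qed.

Lemma finite_set_image (U : finType) (f : U -> T) :
  finite_set (fun x => exists u, x = f u).
Proof.
exists [seq f u | u : U] => x; split=> [[u ->]|/imageP[u _ ->]]; last by exists u.
exact: image_f.
Qed.

End FiniteSets.

(** * Lifts, their initial forms and their images *)

Lemma mpolyX_inj (K : fieldType) n : injective (fun a : 'X_{1..n} => 'X_[a] : {mpoly K[n]}).
Proof. by move=> a b /(congr1 (fun p : {mpoly K[n]} => msupp p : seq _))/=; rewrite !msuppX => -[]. Qed.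

Section Lifts.
Variables (K : fieldType) (R : realFieldType) (n m N : nat).
(** The maps [e1] and [e2] give the two endpoints of an edge, [e1] on the side of the lifted
    polynomial; exchanging them covers the lifts from y. *)
Variables (e1 : 'I_N -> 'I_n) (e2 : 'I_N -> 'I_m).
Variables (adj : 'I_n -> 'I_m -> bool) (z : 'I_n -> 'I_m -> {mpoly K[N]}).
Variables (w1 : 'rV[R]_n) (w2 : 'rV[R]_m) (W : 'rV[R]_N).

Hypothesis zE : forall q, z (e1 q) (e2 q) = 'X_q.
Hypothesis adj_edge : forall q, adj (e1 q) (e2 q).
Hypothesis edge_adj : forall j k, adj j k -> exists q, e1 q = j /\ e2 q = k.
Hypothesis WE : forall q, W 0 q = w1 0 (e1 q) + w2 0 (e2 q).

Lemma all2_edges js ks : all2 adj js ks ->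
  exists qs, js = map e1 qs /\ ks = map e2 qs.
Proof.
elim: js ks => [|j js IH] [|k ks] //=; first by exists [::].
by case/andP => /edge_adj[q [<- <-]] /IH[qs [-> ->]]; exists (q :: qs).
Qed.

Lemma prod_zip_edges qs :
  \prod_(p <- zip (map e1 qs) (map e2 qs)) z p.1 p.2
  = 'X_[(\sum_(q <- qs) U_(q))%MM].
Proof.
rewrite -mprodXE; elim: qs => [|q qs IH]; first by rewrite !big_nil.
by rewrite /= !big_cons IH zE.
Qed.

Lemma mono_ofE js : mono_of K js = 'X_[(\sum_(j <- js) U_(j))%MM] :> {mpoly K[n]}.
Proof. by rewrite -mprodXE. Qed.

Lemma mwt_edges qs : mwt W (\sum_(q <- qs) U_(q))%MM =
  mwt w1 (\sum_(j <- map e1 qs) U_(j))%MM + mwt w2 (\sum_(k <- map e2 qs) U_(k))%MM.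
Proof.
rewrite !mwt_sum !big_map -big_split; apply: eq_bigr => q _.
by rewrite !mwtU WE.
Qed.

Section OneLift.
Variables (f : {mpoly K[n]}) (ord : 'X_{1..n} -> seq 'I_n).
Variables (c : K) (mL : 'X_{1..n}) (ks : seq 'I_m).
Hypothesis ord_adm : admissible_ordering adj w1 f ord.
Hypothesis c0 : c != 0.
Hypothesis inf : init_form w1 f = c *: 'X_[mL].
Hypothesis adj_ks : all2 adj (ord mL) ks.

(** Admissibility carries the adjacency with [ks] over from the leading monomial to every other one,
    so each term of the lift is a product of genuine variables. *)
Lemma lift_edges mm : mm \in msupp f ->
  exists qs, [/\ ord mm = map e1 qs, ks = map e2 qs &
                 (\sum_(j <- map e1 qs) U_(j))%MM = mm].
Proof.
move=> mf; have [ordE adm] := ord_adm.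
have [qs [e e']] := all2_edges (adm _ _ c0 inf _ mf _ adj_ks).
exists qs; split=> //; rewrite -e; apply: (@mpolyX_inj K).
by rewrite -mono_ofE ordE.
Qed.

(** All monomials of the lift share the contribution of [ks] to the weight, so they compare as the
    monomials of [f] do under [w1]. *)
Lemma init_form_lift qs : ord mL = map e1 qs -> ks = map e2 qs ->
  init_form W (lift_k z f ord ks) = c *: 'X_[(\sum_(q <- qs) U_(q))%MM].
Proof.
move=> ordqs ksqs; have [mLf fmL lt_mL] := init_form_monomial c0 inf.
have mLE : (\sum_(j <- map e1 qs) U_(j))%MM = mL.
  by apply: (@mpolyX_inj K); rewrite -mono_ofE -ordqs ord_adm.1.
rewrite /lift_k (bigD1_seq mL) //= fmL {1}ordqs {1}ksqs prod_zip_edges.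
apply: init_form_lead => // x; rewrite -big_filter => /msupp_bigP[mm].
rewrite mem_filter => /andP[nm mf] /msuppZ_le.
have [qs' [-> e' e]] := lift_edges mf.
rewrite {1}e' prod_zip_edges msuppX inE => /eqP ->.
by rewrite !mwt_edges -e' -ksqs ltrD2r e mLE; apply: lt_mL.
Qed.

(** Every term contributes the same product over [ks], which factors out; this puts lifts into the
    glued ideal. *)
Lemma mmap_lift M (h : 'I_N -> {mpoly K[M]}) (x : 'I_n -> {mpoly K[M]})
    (y : 'I_m -> {mpoly K[M]}) : (forall q, h q = x (e1 q) * y (e2 q)) ->
  mmap (@mpolyC M K) h (lift_k z f ord ks)
  = (\prod_(k <- ks) y k) * mmap (@mpolyC M K) x f.
Proof.
move=> hE; rewrite {2}[f]mpolyE /lift_k !raddf_sum mulr_sumr.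
apply: eq_big_seq => mm mf /=; rewrite !mmapZ mulrCA; congr (_ * _).
have [qs [-> e' e]] := lift_edges mf.
rewrite {1}e' prod_zip_edges -e -!mprodXE !rmorph_prod /= e' !big_map -big_split.
by apply: eq_bigr => q _ /=; rewrite !mmapX !mmap1U hE mulrC.
Qed.

End OneLift.

(** Greedy choice: a factor j of the image comes from some edge of [a] at j, which is removed before
    treating the next factor. *)
Lemma choose_edges js (a : 'X_{1..N}) :
  (\sum_(j <- js) U_(j) <= msubst (fun q => U_(e1 q)) a)%MM ->
  exists qs, js = map e1 qs /\ (\sum_(q <- qs) U_(q) <= a)%MM.
Proof.
elim: js a => [|j js IH] a le_a.
  exists [::]; split=> //; rewrite big_nil; apply/mnm_lepP => q.
  by rewrite mnm0E.
have [q qj aq] : exists2 q, e1 q == j & (0 < a q)%N.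
  apply/(sum_gt0P (fun q => e1 q == j) a); have := mnm_lepP le_a j.
  rewrite big_cons mnmDE mnm1E eqxx => /(leq_trans (leq_addr _ _)).
  rewrite mnm_sumE [in X in _ -> X]big_mkcond /=.
  by under eq_bigr do rewrite mulmnE mnm1E mulnbl.
have la : (U_(q) <= a)%MM by rewrite lep1mP -lt0n.
have [|qs [-> le_qs]] := IH (a - U_(q))%MM.
  move: le_a; rewrite -{1}(submK la) msubstD msubstU (eqP qj) big_cons.
  move=> /mnm_lepP h; apply/mnm_lepP => i; move: (h i); rewrite !mnmDE; lia.
exists (q :: qs); rewrite /= (eqP qj); split=> //; rewrite big_cons.
apply/mnm_lepP => i; move: (mnm_lepP le_qs i) (mnm_lepP la i).
by rewrite mnmDE mnmBE; lia.
Qed.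

(** Edges of [a] are chosen over the factors of the leading monomial; their other endpoints are the
    indices of the lift. *)
Lemma reducible_lift (F : seq {mpoly K[n]})
    (ord : {mpoly K[n]} -> 'X_{1..n} -> seq 'I_n) (a : 'X_{1..N}) :
  (forall f, f \in F -> admissible_ordering adj w1 f (ord f)) ->
  reducible w1 F (msubst (fun q => U_(e1 q)%MM) a) ->
  exists g, (exists2 f, f \in F & Lift adj z w1 f (ord f) g) /\
    exists c b, [/\ c != 0, init_form W g = c *: 'X_[b] & (b <= a)%MM].
Proof.
move=> adm [f [c [mL [fF c0 inf lea]]]].
have [mLf _ _] := init_form_monomial c0 inf.
have mLE : (\sum_(j <- ord f mL) U_(j))%MM = mL.
  by apply: (@mpolyX_inj K); rewrite -mono_ofE (adm f fF).1.
move: lea; rewrite -{1}mLE => /choose_edges[qs [ordqs le_qs]].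
have adj_ks : all2 adj (ord f mL) (map e2 qs).
  by rewrite ordqs; elim: (qs) => //= q qs' ->; rewrite adj_edge.
exists (lift_k z f (ord f) (map e2 qs)); split.
  by exists f => //; exists c, mL, (map e2 qs).
exists c, (\sum_(q <- qs) U_(q))%MM; split=> //.
exact: (init_form_lift (adm f fF) c0 inf adj_ks).
Qed.

Lemma finite_Lift (F : seq {mpoly K[n]}) (ord : {mpoly K[n]} -> 'X_{1..n} -> seq 'I_n) :
  finite_set (fun g => exists2 f, f \in F & Lift adj z w1 f (ord f) g).
Proof.
apply: finite_set_bigU => f _.
have fin : finite_set (fun g => exists2 mL, mL \in msupp f &
    exists ks : (size (ord f mL)).-tuple 'I_m, g = lift_k z f (ord f) ks).
  by apply: finite_set_bigU => mL _; apply: finite_set_image.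
apply: finite_set_sub fin _ => g [c [mL [ks [c0 inf adj_ks ->]]]].
have [mLf _ _] := init_form_monomial c0 inf; exists mL => //.
have sk : size ks == size (ord f mL).
  by move: adj_ks; rewrite all2E eq_sym => /andP[].
by exists (Tuple sk).
Qed.

End Lifts.

(** * The weight induced by phi_Q and its effect on H_Q and on initial forms *)

Section Main.
Variables (K : fieldType) (R : realFieldType) (r s : nat) (Q : {set 'I_r * 'I_s}).
Variables (w1 : 'rV[R]_r) (w2 : 'rV[R]_s).
Local Notation N := #|Q|.
Local Notation zidx := (@zidx r s Q).

Definition edge_weight : 'rV[R]_N :=
  row_mx w1 w2 *m map_mx (fun z : int => z%:~R) (@BQ r s Q).

Lemma edge_weightE q : edge_weight 0 q = w1 0 (zidx q).1 + w2 0 (zidx q).2.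
Proof.
rewrite /edge_weight mxE big_split_ord /= (bigD1 (zidx q).1) //= [in X in _ + X](bigD1 (zidx q).2) //=.
rewrite row_mxEl row_mxEr !mxE !big1.
- by rewrite !eqxx eq_lrshift eq_rlshift !addr0 add0r !mulr1.
- move=> k nk; rewrite !mxE eq_rlshift eq_rshift (negPf nk) mulr0 //.
- move=> j nj; rewrite !mxE eq_lrshift eq_lshift (negPf nj) mulr0 //.
Qed.

(** This is the weight-homogeneity of phi_Q. *)
Lemma mwt_edge_weight m : mwt edge_weight m = mwt (row_mx w1 w2) (tmon m).
Proof.
rewrite {1}(multinomUE_id m) /tmon /msubst !mwt_sum; apply: eq_bigr => q _.
have mwtMn n (w : 'rV[R]_n) a k : mwt w (a *+ k)%MM = mwt w a *+ k.
  elim: k => [|k IH]; first by rewrite mulm0n mwt0.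
  by rewrite mulmS mwtD IH mulrS.
by rewrite !mwtMn mwtD !mwtU edge_weightE row_mxEl row_mxEr.
Qed.

Lemma lmnm_tmon m : lmnm (@tmon r s Q m) = msubst (fun q => U_((zidx q).1)%MM) m.
Proof.
apply/mnmP => j; rewrite mnmE !mnm_sumE; apply: eq_bigr => q _.
by rewrite !mulmnE edge_mnm_l mnm1E.
Qed.

Lemma rmnm_tmon m : rmnm (@tmon r s Q m) = msubst (fun q => U_((zidx q).2)%MM) m.
Proof.
apply/mnmP => j; rewrite mnmE !mnm_sumE; apply: eq_bigr => q _.
by rewrite !mulmnE edge_mnm_r mnm1E.
Qed.

Lemma msupp_phiQ (p : {mpoly K[N]}) t : t \in msupp (phiQ p) ->
  exists2 m, m \in msupp p & t = tmon m.
Proof.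
rewrite phiQE => /msupp_bigP[m mp /msuppZ_le].
by rewrite msuppX inE => /eqP ->; exists m.
Qed.

(** Both terms of the binomial have the same image, hence the same weight. *)
Lemma HQ_init (h : {mpoly K[N]}) : HQ h -> phiQ h = 0 /\ init_form edge_weight h = h.
Proof.
case=> l [js [ks [l2 injj injk adj hE]]].
have [[q1 q2] /= hq] := @HQ_binomial K r s Q l js ks (And4 l2 injj injk adj).
rewrite -hE => ->; have e := tmon_cycle hq; split; first by rewrite phiQB !phiQX e subrr.
apply: init_form_homog => m m' /msuppB_le + /msuppB_le.
rewrite !mem_cat !msuppX !inE !mwt_edge_weight.
by do 2![case/orP => /eqP ->]; rewrite ?e.
Qed.

Lemma finite_HQ : finite_set (@HQ K r s Q).
Proof.
have fin : finite_set (fun g : {mpoly K[N]} => exists2 l, l \in iota 0 r.+1 &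
    exists p : {ffun 'I_l -> 'I_r} * {ffun 'I_l -> 'I_s},
      g = \prod_(i < l) zvar K Q (p.1 i) (p.2 i)
          - \prod_(i < l) zvar K Q (p.1 (ordS i)) (p.2 i)).
  by apply: finite_set_bigU => l _; apply: finite_set_image.
apply: finite_set_sub fin _ => g [l [js [ks [_ injj _ _ ->]]]]; exists l.
  (* Injectivity of [js] bounds the length of the cycle by [r]. *)
  by rewrite mem_iota /= add0n ltnS -[l]card_ord -[r]card_ord; apply: leq_card injj.
exists (finfun js, finfun ks) => /=.
by congr (_ - _); apply: eq_bigr => i _; rewrite !ffunE.
Qed.

(** All monomials over a given [t] have the same weight, so the initial form keeps all those
    occurring in [f] or none; hence no coefficient at a surviving [t] changes. *)
Lemma topw_phiQ_init (f : {mpoly K[N]}) t :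
  t \in msupp (phiQ (init_form edge_weight f)) ->
  t \in msupp (phiQ f) /\ topw (row_mx w1 w2) (phiQ f) t.
Proof.
move=> tg; have [m1] := msupp_phiQ tg.
rewrite msupp_init_form => /andP[m1f /allP top1] tE; split; last first.
  apply/allP => u /msupp_phiQ[m2 m2f ->].
  by rewrite tE -!mwt_edge_weight; apply: top1.
have rest : (phiQ (f - init_form edge_weight f))@_t = 0.
  apply: memN_msupp_eq0; apply/negP => /msupp_phiQ[m2].
  rewrite mcoeff_msupp mcoeffB mcoeff_init_form => + t2.
  rewrite ifT ?subrr ?eqxx //; apply/allP => m3 /top1.
  by rewrite !mwt_edge_weight -tE t2.
move: tg; rewrite !mcoeff_msupp -[X in _ -> (phiQ X)@__ != 0](subrK (init_form edge_weight f)).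
by rewrite /phiQ rmorphD mcoeffD -/(phiQ _) rest add0r.
Qed.

End Main.

(** * Lifts and cycle binomials belong to the glued ideal *)

Section Glue.
Variables (K : fieldType) (R : realFieldType) (r s : nat) (Q : {set 'I_r * 'I_s}).
Variables (I : {mpoly K[r]} -> Prop) (J : {mpoly K[s]} -> Prop).

Lemma ideal_sum_ideal : is_ideal (ideal_sum I J).
Proof. exact: ideal_gen_ideal. Qed.

Lemma Lift_glue_x (w : 'rV[R]_r) f ord g : I f ->
  admissible_ordering (adjx Q) w f ord ->
  Lift (adjx Q) (@zvar K r s Q) w f ord g -> glue I J g.
Proof.
move=> If adm [c [mL [ks [c0 inf adj_ks ->]]]].
rewrite /glue /phiQ (mmap_lift (e1 := fun q => (zidx q).1)
  (e2 := fun q => (zidx q).2) _ _ adm c0 inf adj_ks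
  (x := fun j => 'X_(lshift s j)) (y := fun k => 'X_(rshift r k))) //.
- have [_ _ IM] := ideal_sum_ideal.
  by apply: IM; apply: mem_ideal_gen; left; exists f.
- by move=> q; apply: zvarE; apply: surjective_pairing.
- by move=> j k /zidx_onto[q qE]; exists q; rewrite qE.
Qed.

Lemma Lift_glue_y (w : 'rV[R]_s) f ord g : J f ->
  admissible_ordering (adjy Q) w f ord ->
  Lift (adjy Q) (fun k j => @zvar K r s Q j k) w f ord g -> glue I J g.
Proof.
move=> Jf adm [c [mL [ks [c0 inf adj_ks ->]]]].
rewrite /glue /phiQ (mmap_lift (e1 := fun q => (zidx q).2)
  (e2 := fun q => (zidx q).1) _ _ adm c0 inf adj_ks
  (x := fun k => 'X_(rshift r k)) (y := fun j => 'X_(lshift s j))) //.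
- have [_ _ IM] := ideal_sum_ideal.
  by apply: IM; apply: mem_ideal_gen; right; exists f.
- by move=> q; apply: zvarE; apply: surjective_pairing.
- by move=> k j /zidx_onto[q qE]; exists q; rewrite qE.
- by move=> q; rewrite mulrC.
Qed.

Lemma HQ_glue g : @HQ K r s Q g -> glue I J g.
Proof.
(* The zero weights are arbitrary: only the vanishing under phi_Q is used. *)
case/(HQ_init (0 : 'rV[rat]_r) 0) => e _; rewrite /glue e.
by case: ideal_sum_ideal.
Qed.

End Glue.

(** * Assembly: comparison of the two initial ideals *)

Theorem theorem3p7 (K : fieldType) (R : realFieldType) (r s : nat)
  (Q : {set 'I_r * 'I_s})
  (I : {mpoly K[r]} -> Prop) (J : {mpoly K[s]} -> Prop)
  (F : seq {mpoly K[r]}) (G : seq {mpoly K[s]})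
  (w1 : 'rV[R]_r) (w2 : 'rV[R]_s)
  (ordF : {mpoly K[r]} -> 'X_{1..r} -> seq 'I_r)
  (ordG : {mpoly K[s]} -> 'X_{1..s} -> seq 'I_s) :
  (0 < r)%N -> (0 < s)%N ->
  homog_ideal I -> homog_ideal J ->
  is_GB w1 F I -> is_GB w2 G J ->
  (forall f, f \in F -> weakly_Qhomog (adjx Q) w1 f) ->
  (forall g, g \in G -> weakly_Qhomog (adjy Q) w2 g) ->
  (forall f, f \in F -> admissible_ordering (adjx Q) w1 f (ordF f)) ->
  (forall g, g \in G -> admissible_ordering (adjy Q) w2 g (ordG g)) ->
  pseudo_GB (row_mx w1 w2 *m map_mx (fun z : int => z%:~R) (@BQ r s Q))
    (fun p =>
       (exists2 f, f \in F & Lift (adjx Q) (@zvar K r s Q) w1 f (ordF f) p) \/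
       (exists2 g, g \in G &
          Lift (adjy Q) (fun k j => @zvar K r s Q j k) w2 g (ordG g) p) \/
       @HQ K r s Q p)
    (@glue K r s Q I J).
Proof.
move=> _ _ [idI _] [idJ _] GBF GBG wF wG admF admG.
have [[_ FI _] _] := GBF; have [[_ GJ _] _] := GBG.
have homF f : f \in F -> exists d, is_homog d f by case/wF => d []; exists d.
have homG g : g \in G -> exists d, is_homog d g by case/wG => d []; exists d.
rewrite -/(edge_weight Q w1 w2); set W := edge_weight Q w1 w2.
set P := fun p => _ \/ _.
have PI p : P p -> glue I J p.
  case=> [[f fF]|[[g gG]|]]; last exact: HQ_glue.
    by apply: Lift_glue_x; [apply: FI|apply: admF].
  by apply: Lift_glue_y; [apply: GJ|apply: admG].
split => //.
  by apply: finite_setU (finite_Lift _ _ _ _ _) (finite_setU (finite_Lift _ _ _ _ _) (finite_HQ _ _)).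
set L := ideal_gen _ => g; have idL : is_ideal L by apply: ideal_gen_ideal.
split.
  apply: ideal_gen_min; first exact: ideal_gen_ideal.
  by move=> _ [f Pf ->]; apply: mem_ideal_gen; exists f => //; apply: PI.
move=> gI; apply: (ideal_gen_min idL _ gI) => {gI g} _ [f fI ->].
(* Since [L] contains H_Q, it suffices to treat the monomials z^m lying over a surviving monomial of
   the image of the initial form. *)
apply: ideal_of_phiQ => // [h hH|m mt].
  by apply: mem_ideal_gen; exists h; [right; right|rewrite (HQ_init w1 w2 hH).2].
(* It is enough that the initial monomial of some element of [P] divides z^m. *)
have Lmul h c b : P h -> c != 0 -> init_form W h = c *: 'X_[b] -> (b <= m)%MM -> L 'X_[m].
  move=> Ph c0 inh bm; rewrite -(submK bm) mpolyXD.
  have -> : 'X_[b] = c^-1 *: init_form W h by rewrite inh scalerA mulVf // scale1r.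
  case: (idL) => _ _; apply; apply: idealZ => //.
  by apply: mem_ideal_gen; exists h.
have [tf top] := topw_phiQ_init mt.
have [] := reducible_ideal_sum idI idJ GBF GBG homF homG fI tf top.
- rewrite lmnm_tmon => red.
  have [| | | |h [hF [c [b [c0 inh bm]]]]] := reducible_lift (z := @zvar K r s Q)
    (e2 := fun q => (zidx q).2) (w2 := w2) (W := W) _ _ _ _ admF red.
  + by move=> q; apply: zvarE; apply: surjective_pairing.
  + exact: zidxP.
  + by move=> j k /zidx_onto[q qE]; exists q; rewrite qE.
  + exact: edge_weightE.
  + by apply: (Lmul h c b) => //; left.
(* The y-part is symmetric, with endpoints and weights exchanged. *)
- rewrite rmnm_tmon => red.
  have [| | | |h [hG [c [b [c0 inh bm]]]]] := reducible_lift
    (z := fun k j => @zvar K r s Q j k)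
    (e2 := fun q => (zidx q).1) (w2 := w1) (W := W) _ _ _ _ admG red.
  + by move=> q; apply: zvarE; apply: surjective_pairing.
  + exact: zidxP.
  + by move=> k j /zidx_onto[q qE]; exists q; rewrite qE.
  + by move=> q; rewrite addrC; apply: edge_weightE.
  + by apply: (Lmul h c b) => //; right; left.
Qed.
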